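(* Let $\curlywedge(W)$ be a model set in a fully Euclidean cut and project scheme $(\mathbb{R}^d,\mathbb{R}^m,\mathcal{L})$. Then, for each $r,k\in\mathbb{N}$ there exists some $R>0$ such that, no matter how we colour $\curlywedge(W)$ with $r$ colours, for all $y\in\mathbb{R}^d$ the set $\curlywedge(W)\cap B_R(y)$ contains a monochromatic li-arithmetic progression of length $k$ and rank $d+m$.
   Context: Here $d\ge 1$, $m\ge 0$ are integers and $B_R(y)$ is the ball of radius $R$ centred at $y$. A fully Euclidean cut and project scheme (CPS) $(\mathbb{R}^d,\mathbb{R}^m,\mathcal{L})$ consists of $\mathbb{R}^d$, $\mathbb{R}^m$ and a lattice (discrete co-compact subgroup) $\mathcal{L}\subset\mathbb{R}^d\times\mathbb{R}^m$ such that the canonical projection to $\mathbb{R}^d$ is injective on $\mathcal{L}$ and the image of $\mathcal{L}$ under the canonical projection to $\mathbb{R}^m$ is dense in $\mathbb{R}^m$. For $W\subseteq\mathbb{R}^m$, $\curlywedge(W):=\{x\in\mathbb{R}^d : \exists\, y\in W \text{ with } (x,y)\in\mathcal{L}\}$. It is called a (fully Euclidean) model set when $W$ is precompact and has non-empty interior. An li-arithmetic progression of length $N$ and rank $n$ is a set $\{s+c_1r_1+\dots+c_nr_n : c_j\in\mathbb{Z},\ 0\le c_j\le N\ \forall j\}$ with $s,r_1,\dots,r_n\in\mathbb{R}^d$ and $r_1,\dots,r_n$ linearly independent over $\mathbb{Z}$. A subset is monochromatic if all its elements have the same colour. *)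

(* Defs.v *)
From HB Require Import structures.
From mathcomp Require Import all_boot all_order all_algebra.
From mathcomp Require Import all_classical all_reals all_analysis.

Set Implicit Arguments.
Unset Strict Implicit.
Unset Printing Implicit Defensive.

Import Order.TTheory GRing.Theory Num.Theory.
Import numFieldNormedType.Exports.

Local Open Scope quotient_scope.
Local Open Scope classical_set_scope.
Local Open Scope ring_scope.

Definition is_subgroup (V : zmodType) (L : set V) : Prop :=
  L 0 /\ forall x y, L x -> L y -> L (x - y).

Definition coset_rel (V : zmodType) (L : set V) : rel V :=
  fun x y => x - y \in L.

Lemma coset_rel_equiv (V : zmodType) (L : set V) :
  is_subgroup L -> equiv_class_of (coset_rel L).
Proof.
move=> [L0 LB]; have LN x : L x -> L (- x) by rewrite -sub0r; exact: LB.
split.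
- by move=> x; rewrite /coset_rel subrr inE.
- by move=> x y; apply/idP/idP; rewrite /coset_rel !inE => /LN; rewrite opprB.
- move=> y x z; rewrite /coset_rel !inE => Lxy Lyz.
  by rewrite -(subrKA y) -[y - z]opprK; apply: LB; last exact: LN.
Qed.

Canonical coset_equiv (V : zmodType) (L : set V) (hL : is_subgroup L) :
  equiv_rel V := EquivRelPack (coset_rel_equiv hL).

Section cut_and_project.
Context {R : realType} {d m : nat}.
Local Notation V := ('rV[R]_d * 'rV[R]_m)%type.
Implicit Types (L : set V) (W : set 'rV[R]_m).

Definition cocompact L (hL : is_subgroup L) : Prop :=
  compact [set: quotient_topology {eq_quot (coset_equiv hL)}].

Definition is_lattice L : Prop :=
  exists hL : is_subgroup L, L `<=` isolated L /\ cocompact hL.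

Definition is_cps L : Prop :=
  [/\ is_lattice L, set_inj L fst & dense (snd @` L)].

Definition curlywedge L W : set 'rV[R]_d :=
  [set x | exists2 y, W y & L (x, y)].

Definition is_window W : Prop := precompact W /\ W° !=set0.

End cut_and_project.

(* The library's norm and [ball] on ['rV[R]_d] are those of the sup norm. *)
Definition eucl_norm (R : realType) (d : nat) (x : 'rV[R]_d) : R :=
  Num.sqrt (\sum_i x 0 i ^+ 2).

Definition eucl_ball (R : realType) (d : nat) (y : 'rV[R]_d) (rho : R) :
  set 'rV[R]_d := [set x | eucl_norm (x - y) < rho].

Definition Z_independent (V : zmodType) (n : nat) (v : 'I_n -> V) : Prop :=
  forall c : 'I_n -> int, \sum_j v j *~ c j = 0 -> forall j, c j = 0.

Definition li_progression (V : zmodType) (N n : nat) (A : set V) : Prop :=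
  exists (s : V) (v : 'I_n -> V), Z_independent v /\
    A = [set s + \sum_j v j *~ c j |
          c in [set c : 'I_n -> int | forall j, 0 <= c j <= N%:Z]].

Definition monochromatic (T C : Type) (S : set T) (col : set_type S -> C)
    (A : set T) : Prop :=
  forall x y : set_type S, A (val x) -> A (val y) -> col x = col y.

(* Main.v *)
Require Import Defs.
From HB Require Import structures.
From mathcomp Require Import all_boot all_order all_algebra.
From mathcomp Require Import all_classical all_reals all_analysis.
From mathcomp Require Import zify.

(** The theorem is true because a model set contains, in every large ball, an
    affine image of a big integer grid whose dimension is the rank [d + m] of
    the lattice, and because a finite colouring of a big grid contains a
    monochromatic homothetic copy of a small grid.

    The second fact is Gallai's multidimensional form of van der Waerden's
    theorem ([gallai], [gallai_grid]).  It is proved by colour focusing, adding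
    one point to the pattern at a time.  Nothing but addition is used there, so
    the argument is carried out in an arbitrary commutative monoid.

    For the first fact ([model_set_grids]), the size [N] of the grid is given by
    Gallai's theorem.  A grid with origin [(s, s')] in the lattice and with
    steps [l_j] in the lattice stays over the window as soon as [s'] is close to
    an interior point of the window and the internal components of the [l_j]
    are tiny compared with [1 / N].  Two things are needed.

    - Origins occur with bounded gaps.  Compactness of the quotient by the
      lattice gives a cover of the whole space by the lattice translates of a
      product of two balls, the radius of the internal ball being arbitrary
      ([cocompact_cover]).
    - There are [d + m] linearly independent lattice vectors with tiny internal
      component ([small_Z_independent]).  By density of the projection to the
      internal space every lattice vector is an integer combination of such
      vectors, so a linear form that vanishes on these vanishes on the lattice
      ([small_annihilator]).  Such a form takes all its values on a product
      of two balls, so it is bounded, so it is zero ([cocompact_annihilator]).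
      Thus the vectors with tiny internal component span the space, and a basis
      can be extracted from them ([row_free_of_annihilator]).  Injectivity of
      the projection to the physical space carries independence over the
      integers to the physical components. *)

Set Implicit Arguments.
Unset Strict Implicit.
Unset Printing Implicit Defensive.

Import Order.TTheory GRing.Theory Num.Theory.
Import numFieldNormedType.Exports.

Local Open Scope quotient_scope.
Local Open Scope classical_set_scope.
Local Open Scope ring_scope.

(** * Gallai's theorem *)

(** The pair [p] encodes the homothetic copy [p.1 + p.2 F] of [F].  The
    colour is compared with that of the base point [p.1] itself, which amounts
    to assuming that [F] contains 0; this makes the empty pattern trivial and
    gives the colour of a copy a name that does not depend on [F]. *)
Definition mono_copy (V : nmodType) (C : Type) (col : V -> C) (F : seq V)
    (p : V * nat) : Prop :=
  (0 < p.2)%N /\ forall v, v \in F -> col (p.1 + v *+ p.2) = col p.1.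

(** The finiteness of the list [P], which is chosen before the colouring, is
    what makes the theorem uniform; it replaces the usual bound on the size of
    the box. *)
Definition gallai_set (V : nmodType) (F : seq V) : Prop :=
  forall C : finType, exists P : seq (V * nat), forall col : V -> C,
    exists2 p, p \in P & mono_copy col F p.

(** A family of monochromatic copies of [F] in pairwise distinct colours, such
    that completing any one of them into a copy of [u :: F] takes the same point
    [f]. *)
Definition focused (V : nmodType) (C : eqType) (col : V -> C) (F : seq V)
    (u f : V) (s : seq (V * nat)) : Prop :=
  [/\ forall p, p \in s -> mono_copy col F p,
      forall p, p \in s -> p.1 + u *+ p.2 = f &
      uniq [seq col p.1 | p <- s]].

(** Colouring a point [x] by the whole colour pattern of the block [x + B] is
    again a finite colouring; a monochromatic copy for it is a family of
    blocks that look alike. *)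
Lemma gallai_set_block (V : nmodType) (F : seq V) (C : finType) (B : seq V) :
  gallai_set F ->
  exists P : seq (V * nat), forall col : V -> C, exists2 b, b \in P &
    (0 < b.2)%N /\ forall v e, v \in F -> e \in B ->
      col (b.1 + v *+ b.2 + e) = col (b.1 + e).
Proof.
move=> /(_ {ffun 'I_(size B) -> C})[P hP]; exists P => col.
have [b bP [b0 hb]] := hP (fun x => [ffun i : 'I_(size B) => col (x + B`_i)]).
exists b => //; split=> // v e vF eB.
have ieB : (index e B < size B)%N by rewrite index_mem.
by move/ffunP: (hb v vF) => /(_ (Ordinal ieB)); rewrite !ffunE /= nth_index.
Qed.

(** Colour focusing, by induction on the number [q] of focused copies.  A
    block [B] large enough to contain the structure obtained for [q] is repeated
    along a copy of [F] of step [b.2].  Moving each focused copy from block to block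
    while it expands gives [q] copies of step [b.2 + p.2], and the focus itself
    moving from block to block gives a copy in a new colour, unless the focus
    already completes one of the copies inside the first block. *)
Lemma focus_or_copy (V : nmodType) (F : seq V) (u : V) (C : finType) (q : nat) :
  gallai_set F ->
  exists P : seq (V * nat), forall col : V -> C,
    (exists2 p, p \in P & mono_copy col (u :: F) p) \/
    exists f s, [/\ f \in map fst P, {subset s <= P}, size s = q &
                    focused col F u f s].
Proof.
move=> GF; elim: q => [|q [P IH]].
  (* The first component of this pair records the focus of the empty family. *)
  exists [:: (0, 0%N)] => col; right; exists 0, [::].
  by split=> //; rewrite inE.
pose B := [seq p.1 + v *+ p.2 | p <- P, v <- 0 :: F].
have [P1 hP1] := gallai_set_block C B GF.
(* In this order: a copy inside the first block; the copy swept by the focus,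
   when [p] records the focus; an expanded focused copy; the new focus. *)
pose new (b p : V * nat) := [:: (b.1 + p.1, p.2); (b.1 + p.1, b.2);
  (b.1 + p.1, (b.2 + p.2)%N); (b.1 + p.1 + u *+ b.2, 0%N)].
exists (flatten [seq new b p | b <- P1, p <- P]) => col.
have [b bP1 [b0 hb]] := hP1 col.
have newP p x : p \in P -> x \in new b p ->
    x \in flatten [seq new b p | b <- P1, p <- P].
  by move=> pP xn; apply/flattenP; exists (new b p); first exact: allpairs_f.
have BP p v : p \in P -> v \in 0 :: F -> p.1 + v *+ p.2 \in B.
  by move=> pP vF; apply: (allpairs_f (fun p v => _)).
have [[p pP [p0 hp]]|[f [s [/mapP[pf pfP fE] sP sq [smono sf suniq]]]]] :=
    IH (fun x => col (b.1 + x)).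
  left; exists (b.1 + p.1, p.2).
    by apply: (newP p) => //; rewrite !inE eqxx.
  by split=> //= v vF; rewrite -addrA hp.
have [/mapP[p ps colp]|fresh] :=
    boolP (col (b.1 + f) \in [seq col (b.1 + p.1) | p <- s]).
  left; exists (b.1 + p.1, p.2).
    by apply: (newP p); rewrite ?sP// !inE eqxx.
  have [p0 hp] := smono _ ps; split=> //= v; rewrite inE -addrA.
  move=> /predU1P[->|vF]; first by rewrite sf.
  exact: hp.
right; exists (b.1 + f + u *+ b.2).
exists ((b.1 + f, b.2) :: [seq (b.1 + p.1, (b.2 + p.2)%N) | p <- s]); split.
- apply/mapP; exists (b.1 + f + u *+ b.2, 0%N) => //.
  by apply: (newP pf) => //; rewrite fE !inE eqxx !orbT.
- move=> x; rewrite inE => /predU1P[->|/mapP[p ps ->]].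
    by apply: (newP pf) => //; rewrite fE !inE eqxx !orbT.
  by apply: (newP p); rewrite ?sP// !inE eqxx !orbT.
- by rewrite /= size_map sq.
split.
- move=> x; rewrite inE => /predU1P[->|/mapP[p ps ->]]; split=> //=.
  + move=> v vF; rewrite addrAC hb// fE -[pf.1]addr0 -(mul0rn _ pf.2) BP//.
    by rewrite mem_head.
  + by rewrite addn_gt0 b0.
  + move=> v vF; have [_ /(_ v vF) hp] := smono p ps.
    rewrite mulrnDr addrACA hb// BP ?sP//.
    by rewrite inE vF orbT.
- move=> x; rewrite inE => /predU1P[->|/mapP[p ps ->]] //=.
  by rewrite mulrnDr addrACA (sf p ps) addrAC.
- by rewrite /= -map_comp fresh.
Qed.

(** Gallai's theorem: with more focused copies than colours, their colours
    cannot be distinct, so a copy of the longer pattern must exist. *)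
Theorem gallai (V : nmodType) (F : seq V) : gallai_set F.
Proof.
elim: F => [C|u F GF C].
  by exists [:: (0, 1%N)] => col; exists (0, 1%N); rewrite ?mem_head.
have [P hP] := focus_or_copy u C #|C|.+1 GF; exists P => col.
have [//|[f [s [_ _ sq [_ _ Us]]]]] := hP col.
have := uniq_leq_size Us (fun x _ => mem_enum C x).
by rewrite size_map sq -cardT ltnn.
Qed.

(** * Lattices and linear forms *)

(** A set of row vectors on which no nonzero linear form vanishes contains a
    basis: as long as there are fewer than [n] independent rows, some nonzero
    column is orthogonal to them, and any vector of [S] not orthogonal to that
    column can be added. *)
Lemma row_free_of_annihilator (F : fieldType) (n : nat) (S : set 'rV[F]_n) :
  (forall z : 'cV_n, (forall s, S s -> s *m z = 0) -> z = 0) ->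
  exists2 M : 'M[F]_n, row_free M & forall i, S (row i M).
Proof.
move=> S0; suff: forall k, (k <= n)%N ->
    exists2 M : 'M[F]_(k, n), row_free M & forall i, S (row i M) by apply.
elim=> [_|k IH kn].
  by exists 0; [rewrite /row_free mxrank0 | case].
have [M fM SM] := IH (ltnW kn).
have /matrix0Pn[i [j Mij]] : cokermx M != 0.
  by rewrite cokermx_eq0 /row_full neq_ltn (leq_ltn_trans (rank_leq_row M)).
pose z := col j (cokermx M).
have Mz : M *m z = 0 by rewrite /z colE mulmxA mulmx_coker mul0mx.
have [s Ss sz] : exists2 s, S s & s *m z != 0.
  apply: contrapT => h; suff /S0/colP/(_ i) : forall s, S s -> s *m z = 0.
    by rewrite mxE [RHS]mxE => /eqP; exact/negP.
  by move=> s Ss; apply: contrapT => /eqP sz; apply: h; exists s.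
exists (col_mx s M : 'M[F]_((1 + k)%N, n)).
  apply: (inj_row_free (A := col_mx s M)) => v.
  rewrite -[v]hsubmxK mul_row_col => vM.
  have l0 : lsubmx v = 0.
    have := congr1 (mulmxr z) vM; rewrite /= mulmxDl -!mulmxA Mz mulmx0 addr0.
    rewrite mul0mx [lsubmx v]mx11_scalar mul_scalar_mx => /eqP.
    by rewrite scaler_eq0 (negPf sz) orbF => /eqP ->; rewrite raddf0.
  move: vM; rewrite l0 mul0mx add0r => /eqP; rewrite mulmx_free_eq0// => /eqP ->.
  by rewrite row_mx0.
suff Srow (i0 : 'I_(1 + k)%N) : S (row i0 (col_mx s M)) by [].
rewrite -[i0]splitK; case: (fintype.split i0) => p /=; last by rewrite rowKd.
by rewrite rowKu [p]ord1 row_id.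
Qed.

Lemma subgroupD (V : zmodType) (L : set V) x y :
  is_subgroup L -> L x -> L y -> L (x + y).
Proof.
move=> [L0 LB] Lx Ly; rewrite -[y]opprK -[- y]sub0r.
by apply: (LB) => //; exact: LB.
Qed.

Lemma subgroupMz (V : zmodType) (L : set V) x (c : int) :
  is_subgroup L -> L x -> L (x *~ c).
Proof.
move=> hL Lx; have LMn p : L (x *+ p).
  by elim: p => [|p IH]; [case: hL | rewrite mulrS; exact: subgroupD].
case: c => p; first exact: LMn.
by rewrite NegzE mulrNz -sub0r; case: (hL) => L0; apply; last exact: LMn.
Qed.

Lemma subgroup_comb (V : zmodType) (L : set V) n (l : 'I_n -> V)
    (c : 'I_n -> int) :
  is_subgroup L -> (forall j, L (l j)) -> L (\sum_j l j *~ c j).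
Proof.
move=> hL Ll; elim/big_ind: _ => [|x y|j _]; first by case: hL.
- exact: subgroupD.
- exact: subgroupMz.
Qed.

Section lattice.
Context {R : realType} {d m : nat}.
Local Notation V := ('rV[R]_d * 'rV[R]_m)%type.
Implicit Types (L : set V).

(** The sets [U n] below are open, increase with [n], are invariant under [L],
    and exhaust the space because the internal projection of [L] is dense.
    Compactness of the quotient makes one of them the whole space. *)
Lemma cocompact_cover L (hL : is_subgroup L) (w : 'rV[R]_m) (e : R) :
  cocompact hL -> dense (snd @` L) -> 0 < e ->
  exists n : nat, forall v : V, exists2 l, L l &
    ball l.1 n%:R v.1 /\ ball (w + l.2) e v.2.
Proof.
move=> /compact_near_coveringP cL dL e0; set Q := quotient_topology _ in cL.
have [L0 LB] := hL.
pose U n : set V := \bigcup_(l in L)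
  (fst @^-1` ball l.1 n%:R `&` snd @^-1` ball (w + l.2) e).
have oU n : open (U n).
  apply: bigcup_open => l _.
  have /continuousP cfst : continuous (fst : V -> _) by move=> x; exact: cvg_fst.
  have /continuousP csnd : continuous (snd : V -> _) by move=> x; exact: cvg_snd.
  by apply: openI; [apply: cfst | apply: csnd]; exact: ball_open.
have UL n x y : L (x - y) -> U n x -> U n y.
  move=> Lxy [l Ll [] /=]; rewrite -!ball_normE /= => h1 h2.
  exists (l - (x - y)); first exact: LB.
  split; rewrite /= -ball_normE /=.
    by rewrite opprB -addrA (addrAC y.1) subrr add0r.
  by rewrite opprB -!addrA (addrCA y.2) subrr addr0 addrA.
pose f n : set Q := [set q | U n (repr q)].
have piU n : (\pi_Q : V -> Q) @^-1` f n = U n.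
  have rpi x : L (repr (\pi_Q x) - x).
    have /eqmodP : \pi_Q (repr (\pi_Q x)) = \pi_Q x :> {eq_quot (coset_equiv hL)}.
      by rewrite reprK.
    by rewrite /= /coset_rel inE.
  apply/seteqP; split=> x /=; first exact: UL.
  apply: UL; rewrite -opprB -sub0r.
  exact: LB.
have Ule n n' x : (n <= n')%N -> U n x -> U n' x.
  move=> nn' [l Ll [h1 h2]]; exists l => //; split=> //.
  by apply: le_ball h1; rewrite ler_nat.
have Uex x : exists n, U n x.
  have [|_ [/[swap] [[l Ll <-]]]] := dL (ball (x.2 - w) e) _ (ball_open _ _).
    by exists (x.2 - w); exact: ballxx.
  rewrite -ball_normE /= => xe.
  exists (Num.bound `|l.1 - x.1|); exists l => //.
  split; rewrite /= -ball_normE /=; first exact: archi_boundP.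
  by rewrite distrC opprD addrA.
have [|N _ hN] := cL nat \oo f _.
  move=> q _; have [n Un] := Uex (repr q).
  exists (f n, [set n' | (n <= n')%N]) => /=.
    split; last by exists n.
    apply: (@open_nbhs_nbhs Q q (f n)); split=> //.
    by rewrite /open /= /quotient_open piU.
  by move=> [q' n'] [/= fq' nn']; exact: Ule fq'.
exists N => v; have: U N v by rewrite -piU; apply: hN => /=.
by move=> [l Ll []]; exists l.
Qed.

Lemma coord_le_norm p (x : 'rV[R]_p) i : `|x 0 i| <= `|x|.
Proof.
rewrite [leRHS]/Num.norm /= mx_normrE.
by apply: le_trans (le_bigmax _ _ (0, i)); rewrite /=.
Qed.

(** The identification of the product of the two spaces with one space of row
    vectors, where ranks and linear forms are available. *)
Definition glue (v : V) : 'rV[R]_(d + m) := row_mx v.1 v.2.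

Lemma glue_is_linear : linear glue.
Proof. by move=> a u v; rewrite /glue scale_row_mx add_row_mx. Qed.

HB.instance Definition _ := GRing.isLinear.Build R V 'rV[R]_(d + m) _ glue
  glue_is_linear.

Lemma glueK u : glue (lsubmx u, rsubmx u) = u.
Proof. exact: hsubmxK. Qed.

(** A linear form that vanishes on [L] takes all its values on a bounded
    set of representatives modulo [L], so it is bounded, so it is zero. *)
Lemma cocompact_annihilator L (hL : is_subgroup L) (z : 'cV[R]_(d + m)) :
  cocompact hL -> dense (snd @` L) ->
  (forall l, L l -> glue l *m z = 0) -> z = 0.
Proof.
move=> cL dL Lz; have [n hn] := cocompact_cover 0 cL dL ltr01.
pose f (v : V) := (glue v *m z) 0 0.
pose B := \sum_j (n%:R + 1) * `|z j 0|.
have fB v : `|f v| <= B.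
  have [l Ll [+ +]] := hn v; rewrite -!ball_normE /= add0r => v1 v2.
  have -> : f v = (glue (v - l) *m z) 0 0.
    by rewrite raddfB mulmxBl (Lz l)// subr0.
  rewrite mxE (le_trans (ler_norm_sum _ _ _))// ler_sum// => j _.
  rewrite normrM ler_wpM2r// -[j]splitK.
  case: (fintype.split j) => i /=; rewrite ?row_mxEl ?row_mxEr.
    rewrite (le_trans (coord_le_norm _ _))// distrC.
    by rewrite (le_trans (ltW v1))// lerDl.
  rewrite (le_trans (coord_le_norm _ _))// distrC (le_trans (ltW v2))//.
  by rewrite lerDr.
have f0 v : f v = 0.
  apply: contrapT => /eqP fv.
  (* At this multiple of [v] the form takes the value [B + 1]. *)
  have := fB (((B + 1) / f v) *: v).
  rewrite /f linearZ -scalemxAl mxE -/(f v) divfK// => /ler_normlW.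
  by rewrite gerDl ler10.
apply/row_matrixP => j; rewrite rowE row0; apply/matrixP => a b.
by rewrite !ord1 -[delta_mx 0 j]glueK [RHS]mxE; exact: f0.
Qed.

(** Every [l] in [L] is an integer combination of two elements of [L] with small
    internal component: choose [l'] in [L] whose internal component approximates
    that of [l] divided by a large [n], within [e / n]; then
    [l = (l - n l') + n l']. *)
Lemma small_annihilator L (e : R) (z : 'cV[R]_(d + m)) :
  is_subgroup L -> dense (snd @` L) -> 0 < e ->
  (forall l, L l -> `|l.2| < e -> glue l *m z = 0) ->
  forall l, L l -> glue l *m z = 0.
Proof.
move=> hL dL e0 Lz l Ll.
pose n := (Num.bound (`|l.2| / e)).+1.
have n0 : 0 < n%:R :> R by rewrite ltr0n.
have ln : `|l.2| + e < e * n%:R.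
  rewrite /n -natr1 mulrDr mulr1 ltrD2r mulrC -ltr_pdivrMr//.
  by apply: archi_boundP; rewrite divr_ge0// ltW.
have [|_ [/[swap] [[l' Ll' <-]]]] :=
    dL (ball (n%:R^-1 *: l.2) (e / n%:R)) _ (ball_open _ _).
  by exists (n%:R^-1 *: l.2); apply: ballxx; exact: divr_gt0.
rewrite -ball_normE /= => near_l.
have l'_small : `|l'.2| < e.
  rewrite -[l'.2](subKr (n%:R^-1 *: l.2)) (le_lt_trans (ler_normB _ _))//.
  rewrite normrZ ger0_norm ?invr_ge0 ?ltW// mulrC.
  rewrite (lt_trans (_ : _ < `|l.2| / n%:R + e / n%:R)) ?ltrD2l//.
  by rewrite -mulrDl ltr_pdivrMr.
have diff_small : `|(l - l' *+ n).2| < e.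
  have -> : (l - l' *+ n).2 = n%:R *: (n%:R^-1 *: l.2 - l'.2).
    rewrite scalerBr scalerA divff ?gt_eqF// scale1r scaler_nat /=.
    by rewrite (raddfMn snd).
  by rewrite normrZ ger0_norm ?ltW// mulrC -ltr_pdivlMr.
have rest : glue (l - l' *+ n) *m z = 0.
  apply: Lz => //; case: (hL) => _; apply => //.
  exact: (subgroupMz (Posz n)).
rewrite -(subrK (l' *+ n) l) raddfD mulmxDl rest add0r /=.
by rewrite -(scaler_nat (V := V)) linearZ -scalemxAl Lz ?scaler0.
Qed.

(** Independence over the reals in the product space gives independence over
    the integers of the physical components, since an integer relation between
    the latter is, by injectivity, a relation between the lattice vectors. *)
Lemma small_Z_independent L (e : R) : is_cps L -> 0 < e ->
  exists l : 'I_(d + m) -> V,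
    (forall j, L (l j) /\ `|(l j).2| < e) /\ Z_independent (fun j => (l j).1).
Proof.
move=> [[hL [_ cL]] Linj dL] e0.
pose S : set 'rV[R]_(d + m) := [set glue l | l in [set l | L l /\ `|l.2| < e]].
have [z Sz|M fM SM] := @row_free_of_annihilator R (d + m) S.
  apply: (cocompact_annihilator cL dL); apply: (small_annihilator hL dL e0).
  by move=> l Ll le; apply: Sz; exists l.
have /choice[l hl] j : exists l, [/\ L l, `|l.2| < e & glue l = row j M].
  by have [l [Ll le] lM] := SM j; exists l.
exists l; split=> [j|c c0 j]; first by have [] := hl j.
have Lsum : L (\sum_j l j *~ c j).
  by apply: subgroup_comb => // i; have [] := hl i.
have sum0 : \sum_j l j *~ c j = 0.
  apply: Linj; rewrite ?inE //; first by have [] := hL.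
  by rewrite (raddf_sum fst) -[RHS]c0; apply: eq_bigr => i _;
    rewrite (raddfMz fst).
pose u : 'rV[R]_(d + m) := \row_j (c j)%:~R.
have : u *m M = 0.
  rewrite mulmx_sum_row -[RHS](raddf0 glue) -sum0 raddf_sum.
  apply: eq_bigr => i _; have [_ _ <-] := hl i.
  by rewrite mxE scaler_int raddfMz.
move/eqP; rewrite mulmx_free_eq0// => /eqP/rowP/(_ j)/eqP.
by rewrite !mxE intr_eq0 => /eqP.
Qed.

End lattice.

(** * Grids in model sets *)

(** Gallai's theorem for the pattern of all points of the grid with
    coordinates at most [k]. *)
Lemma gallai_grid (n k r : nat) :
  exists N : nat, forall chi : ('I_n -> nat) -> 'I_r,
    exists (a : 'I_n -> nat) (t : nat),
      [/\ (0 < t)%N, forall j, (a j + k * t <= N)%N &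
          forall c : 'I_n -> nat, (forall j, c j <= k)%N ->
            chi (fun j => a j + c j * t)%N = chi a].
Proof.
pose F : seq {ffun 'I_n -> nat} :=
  [seq [ffun j => nat_of_ord (g j)] | g : {ffun 'I_n -> 'I_k.+1}].
have [P hP] := gallai F 'I_r.
exists (\max_(p <- P) \max_(j < n) (p.1 j + k * p.2))%N => chi.
have [p pP [p0 hp]] := hP (fun x => chi x).
exists p.1, p.2; split=> // [j|c ck].
  apply: leq_trans (leq_bigmax_seq _ pP isT) => /=.
  exact: (leq_bigmax (F := fun j => (p.1 j + k * p.2)%N) j).
rewrite -(hp [ffun j => c j]).
  congr chi; apply: funext => j.
  by rewrite !ffunE ffunMnE ffunE -mulr_natr natn.
apply/mapP; exists [ffun j => inord (c j)]; first by rewrite mem_enum.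
by apply/ffunP => j; rewrite !ffunE inordK// ltnS.
Qed.

Lemma eucl_norm_le_sup (R : realType) (d : nat) (x : 'rV[R]_d) (M : R) :
  `|x| <= M -> eucl_norm x <= Num.sqrt (d%:R * M ^+ 2).
Proof.
move=> xM; rewrite /eucl_norm ler_wsqrtr//.
rewrite -[X in X%:R](card_ord d) -sumr_const mulr_suml ler_sum// => i _.
rewrite mul1r -(real_normK (num_real _)) lerXn2r ?nnegrE ?(le_trans _ xM)//.
exact: coord_le_norm.
Qed.

Lemma grid_comb_norm (R : realType) (n p N : nat) (u : 'I_n -> 'rV[R]_p)
    (c : 'I_n -> int) :
  (forall j, 0 <= c j <= N%:Z) ->
  `|\sum_j u j *~ c j| <= \sum_j `|u j| * N%:R.
Proof.
move=> cN; rewrite (le_trans (ler_norm_sum _ _ _))// ler_sum// => j _.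
have /andP[c0 cj] := cN j.
rewrite -scaler_int normrZ mulrC ler_wpM2l//.
by rewrite ger0_norm ?ler0z// -[N%:R]/(N%:Z%:~R) ler_int.
Qed.

(** The steps [v] are the physical components of lattice vectors whose internal
    components are smaller than [delta], so that all internal components of the
    grid stay within [e / 2] of that of its origin. *)
Lemma model_set_grids (R : realType) (d m : nat)
    (L : set ('rV[R]_d * 'rV[R]_m)) (W : set 'rV[R]_m) (N : nat) :
  is_cps L -> W° !=set0 ->
  exists2 v : 'I_(d + m) -> 'rV[R]_d, Z_independent v &
  exists2 rho : R, 0 < rho & forall y : 'rV[R]_d, exists s : 'rV[R]_d,
    forall c : 'I_(d + m) -> int, (forall j, 0 <= c j <= N%:Z) ->
      (curlywedge L W `&` eucl_ball y rho) (s + \sum_j v j *~ c j).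
Proof.
move=> hL [w /nbhs_ballP[e /= e0 We]].
have [[hL' [_ cL]] _ dL] := hL.
pose delta := e / 2 / ((d + m) * N).+1%:R.
have e20 : 0 < e / 2 by rewrite divr_gt0.
have delta0 : 0 < delta by rewrite divr_gt0.
have [l [Ll Zl]] := small_Z_independent hL delta0.
(* Covering the point [(y, 0)] by a translate of a ball centred at [- w] yields
   a lattice point over [y] whose internal component is close to [w]. *)
have [n hn] := cocompact_cover (- w) cL dL e20.
exists (fun j => (l j).1) => //.
pose M := n%:R + \sum_j `|(l j).1| * N%:R.
exists (Num.sqrt (d%:R * M ^+ 2) + 1); first by rewrite ltr_wpDl ?sqrtr_ge0.
move=> y; have [l0 Ll0 [+ +]] := hn (y, 0).
rewrite -!ball_normE /= subr0 => l0y l0w.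
exists l0.1 => c cN; split.
  exists (l0.2 + \sum_j (l j).2 *~ c j).
    apply: We; rewrite -ball_normE /= opprD addrA.
    rewrite (le_lt_trans (ler_normB _ _))// [ltRHS]splitr ltr_leD//.
      by rewrite distrC addrC.
    rewrite (le_trans (grid_comb_norm _ cN))//.
    apply: (@le_trans _ _ (\sum_(j < d + m) delta * N%:R)).
      by apply: ler_sum => j _; rewrite ler_wpM2r// ltW//; have [] := Ll j.
    rewrite sumr_const card_ord -[leLHS]mulr_natr -mulrA -natrM -mulrA.
    rewrite ler_piMr ?(ltW e20)//.
    by rewrite mulrC ler_pdivrMr// mul1r ler_nat mulnC leqW.
  have -> : (l0.1 + \sum_j (l j).1 *~ c j, l0.2 + \sum_j (l j).2 *~ c j) =
            l0 + \sum_j l j *~ c j.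
    rewrite [RHS]surjective_pairing /= (raddf_sum fst) (raddf_sum snd).
    by congr (_ + _, _ + _); apply: eq_bigr => j _;
      rewrite (raddfMz fst, raddfMz snd).
  by apply: subgroupD => //; apply: subgroup_comb => // j; have [] := Ll j.
rewrite /eucl_ball /= ltr_pwDr// eucl_norm_le_sup// addrAC.
by rewrite (le_trans (ler_normD _ _))// lerD ?(ltW l0y)// grid_comb_norm.
Qed.

Theorem theorem4p7 (R : realType) (d m : nat) (hd : (1 <= d)%N)
    (L : set ('rV[R]_d * 'rV[R]_m)) (W : set 'rV[R]_m)
    (hL : is_cps L) (hW : is_window W) :
  forall r k : nat, exists2 rho : R, 0 < rho &
    forall (col : set_type (curlywedge L W) -> 'I_r) (y : 'rV[R]_d),
      exists A : set 'rV[R]_d,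
        [/\ li_progression k (d + m) A,
            A `<=` curlywedge L W `&` eucl_ball y rho &
            monochromatic col A].
Proof.
move=> r k; have [_ W0] := hW.
have [N hN] := gallai_grid (d + m) k r.
have [v Zv [rho rho0 hrho]] := model_set_grids N hL W0.
exists rho => // col y; have [s hs] := hrho y.
(* Truncating the coordinates at [N] turns a colouring of the model set into a
   colouring of the whole integer grid. *)
pose pt (c : 'I_(d + m) -> nat) : 'rV[R]_d := s + \sum_j v j *+ minn (c j) N.
have ptP c : (curlywedge L W `&` eucl_ball y rho) (pt c).
  by apply: (hs (fun j => (minn (c j) N)%:Z)) => j; rewrite lez_nat geq_minr.
have ptL c : pt c \in curlywedge L W by apply: mem_set; have [] := ptP c.
have [a [t [t0 aN chi]]] := hN (fun c => col (SigSub (ptL c))).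
pose v' j := v j *+ t.
have ptE (c : 'I_(d + m) -> int) : (forall j, 0 <= c j <= k%:Z) ->
    exists2 c' : 'I_(d + m) -> nat, (forall j, c' j <= k)%N &
    pt a + \sum_j v' j *~ c j = pt (fun j => a j + c' j * t)%N.
  move=> ck; exists (fun j => `|c j|%N) => [j|]; first by have := ck j; lia.
  rewrite /pt -addrA -big_split; congr (_ + _); apply: eq_bigr => j _ /=.
  rewrite /v' !pmulrn -mulrzA -mulrzDr; congr (_ *~ _).
  by have := ck j; have := aN j; nia.
exists [set pt a + \sum_j v' j *~ c j |
  c in [set c : 'I_(d + m) -> int | forall j, 0 <= c j <= k%:Z]]; split.
- exists (pt a), v'; split=> // c c0 j.
  have /Zv/(_ j)/eqP : \sum_j v j *~ (t%:Z * c j) = 0.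
    by rewrite -[RHS]c0; apply: eq_bigr => i _; rewrite mulrzA.
  by rewrite mulf_eq0 eqz_nat (gtn_eqF t0) => /eqP.
- by move=> _ [c ck <-]; have [c' _ ->] := ptE c ck.
- have colE x c : (forall j, 0 <= c j <= k%:Z) ->
      pt a + \sum_j v' j *~ c j = val x -> col x = col (SigSub (ptL a)).
    move=> ck; have [c' c'k ->] := ptE c ck => xE.
    by rewrite -(chi c' c'k); congr col; exact: val_inj.
  by move=> x1 x2 [c1 /colE E1 /E1 ->] [c2 /colE E2 /E2 ->].
Qed.
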